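(* For every integer $\ell\ge 1$ define $$A_{\otimes\ell}=\frac1d\,C_1^{\otimes \ell}+\cdots+\frac1d\,C_d^{\otimes \ell},$$ where $C^{\otimes\ell}$ is the $\ell$-th Kronecker power of $C$. Then the Cesàro limit $\lim_{M\to\infty}\frac1M\sum_{m=1}^M A_{\otimes\ell}^{\,m}$ of the powers of $A_{\otimes \ell}$ exists and equals $$\Omega_{\otimes\ell}=\langle K^{\otimes\ell}\rangle=\sum_{k\in\mathcal K}\lambda(k)\,k^{\otimes\ell},$$ the average being taken over the kernel $\mathcal K$ of the semigroup $\mathcal S$ generated by $\{C_1,\dots,C_d\}$.
   Context: Setting: $\mathcal A$ is the adjacency matrix of a directed graph on $n$ vertices that is $d$-out-regular, and $A=d^{-1}\mathcal A$ is assumed irreducible and aperiodic. $A=\frac1d(C_1+\cdots+C_d)$, where each $C_i$ is an $n\times n$ binary stochastic matrix (entries $0,1$, exactly one $1$ in each row; i.e. the matrix of a function $f$ on $\{1,\dots,n\}$, with $(i,j)$ entry $1$ iff $f(i)=j$). $\mathcal S$ is the finite semigroup generated by $C_1,\dots,C_d$ under matrix multiplication. Its kernel $\mathcal K$ is its minimal (two-sided) ideal, which is the set of elements of $\mathcal S$ of minimal rank. $\mu^{(1)}$ is the probability measure on $\mathcal S$ with $\mu^{(1)}(w)=\frac1d\#\{i: C_i=w\}$, and $\mu^{(m)}$ is its $m$-th convolution power (the law of the product of $m$ independent $\mu^{(1)}$-distributed elements). $\lambda(w)=\lim_{M\to\infty}\frac1M\sum_{m=1}^M\mu^{(m)}(w)$;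 it is known that this limit exists for every $w\in\mathcal S$ and that $\lambda$ is a probability measure supported on $\mathcal K$. $\langle f(K)\rangle=\sum_{k\in\mathcal K}\lambda(k)f(k)$. *)

(* Defs.v *)
(* MathComp / MathComp-Analysis *)
From HB Require Import structures.
From mathcomp Require Import all_boot all_order all_algebra all_character.
From mathcomp Require Import all_classical all_reals all_analysis.
Set Implicit Arguments.
Unset Strict Implicit.
Unset Printing Implicit Defensive.
Import Order.TTheory GRing.Theory Num.Theory.
Import numFieldNormedType.Exports.
Local Open Scope classical_set_scope.
Local Open Scope ring_scope.

(* [D i j] is the number of edges from [i] to [j], so parallel edges are
   allowed; they occur when several of the [C i] share an entry. *)
Definition out_regular (n d : nat) (D : 'M[nat]_n) : Prop :=
  forall i : 'I_n, (\sum_(j < n) D i j)%N = d.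

Definition irreducible_mx (R : realType) (n : nat) (A : 'M[R]_n) : Prop :=
  forall i j : 'I_n, exists m : nat, (0 < m)%N /\ 0 < (A ^+ m) i j.

(* The return times at each state have greatest common divisor 1. *)
Definition aperiodic_mx (R : realType) (n : nat) (A : 'M[R]_n) : Prop :=
  forall (i : 'I_n) (g : nat),
    (forall m : nat, (0 < m)%N -> 0 < (A ^+ m) i i -> (g %| m)%N) -> g = 1%N.

Definition binary_stochastic (R : realType) (n : nat) (C : 'M[R]_n) : Prop :=
  (forall i j : 'I_n, C i j = 0 \/ C i j = 1) /\
  (forall i : 'I_n, exists! j : 'I_n, C i j = 1).

Section Semigroup.
Variables (R : realType) (n d : nat).
Implicit Types (S I K : set 'M[R]_n) (C : 'I_d -> 'M[R]_n).

Definition mulmx_closed S : Prop := forall x y, S x -> S y -> S (x *m y).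

Definition semigroup_gen C : set 'M[R]_n := smallest mulmx_closed (range C).

Definition two_sided_ideal S I : Prop :=
  [/\ I !=set0, I `<=` S &
      forall s x, S s -> I x -> I (s *m x) /\ I (x *m s)].

Definition minimal_ideal S K : Prop :=
  two_sided_ideal S K /\
  forall I, two_sided_ideal S I -> I `<=` K -> I = K.

(* A minimal two-sided ideal is unique when it exists, and it exists for every
   nonempty finite [S]; the default value [set0] is then not used. *)
Definition semigroup_kernel S : set 'M[R]_n := xget set0 (minimal_ideal S).

(* Measures on [S] are given by their mass functions. *)
Definition mu1 C (w : 'M[R]_n) : R := d%:R^-1 * #|[set i | C i == w]%SET|%:R.

Definition convolution S (mu nu : 'M[R]_n -> R) (w : 'M[R]_n) : R :=
  \sum_(p \in [set p : 'M[R]_n * 'M[R]_n | [/\ S p.1, S p.2 & p.1 *m p.2 = w]])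
     mu p.1 * nu p.2.

(* Meaningful for [0 < m] only: [mu C 1 = mu1 C], and the value at [m = 0] is
   not used. *)
Definition mu C (m : nat) : 'M[R]_n -> R :=
  iter m.-1 (convolution (semigroup_gen C) (mu1 C)) (mu1 C).

End Semigroup.

Definition cesaro_mean (R : realType) (V : lmodType R) (u : nat -> V)
    (M : nat) : V :=
  M%:R^-1 *: \sum_(1 <= m < M.+1) u m.

Definition lambda (R : realType) (n d : nat) (C : 'I_d -> 'M[R]_n)
    (w : 'M[R]_n) : R :=
  lim (cesaro_mean (fun m => mu C m w : R^o) @ \oo).

(* [tprod] is the Kronecker product; the cast identifies [n * n ^ l] with
   [n ^ l.+1]. *)
Fixpoint kron_pow (R : realType) (n : nat) (C : 'M[R]_n) (l : nat) :
    'M[R]_(n ^ l) :=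
  if l is l'.+1 then
    castmx (esym (expnS n l'), esym (expnS n l')) (tprod C (kron_pow C l'))
  else 1%:M.

Definition A_tensor (R : realType) (n d : nat) (C : 'I_d -> 'M[R]_n) (l : nat) :
    'M[R]_(n ^ l) :=
  \sum_(i < d) d%:R^-1 *: kron_pow (C i) l.

Definition Omega_tensor (R : realType) (n d : nat) (C : 'I_d -> 'M[R]_n)
    (l : nat) : 'M[R]_(n ^ l) :=
  \sum_(k \in semigroup_kernel (semigroup_gen C)) lambda C k *: kron_pow k l.

(* Main.v *)
Require Import Defs.
From HB Require Import structures.
From mathcomp Require Import all_boot all_order all_algebra all_character.
From mathcomp Require Import finmap.
From mathcomp Require Import all_classical all_reals all_analysis.
Import Order.TTheory GRing.Theory Num.Theory.
Import numFieldNormedType.Exports.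
Local Open Scope classical_set_scope.
Local Open Scope ring_scope.

(** The map [w |-> kron_pow w l] is multiplicative ([kron_powM]), so expanding
    [A_tensor C l ^+ m] collects the products of [m] generators according to
    their value in the semigroup [S]:
      [A_tensor C l ^+ m = \sum_(w in S) mu C m w *: kron_pow w l].
    As [S] is finite, the Cesaro means of the left-hand side converge as soon
    as those of each [mu C m w] do, with limit
    [\sum_(w in S) lambda C w *: kron_pow w l]; two facts remain.

    Existence of [lambda].  The sequence [mu C m] is the law of the random walk
    on [S] that multiplies on the left by a uniformly chosen generator
    ([mu_step]), i.e. the orbit of [mu1 C] under a row-stochastic matrix [P].
    A matrix with bounded orbits is Cesaro convergent ([mean_ergodic]): the
    space is the direct sum of the kernel and the image of [1 - P]; vectors
    of the kernel do not move, and on the image the sums telescope to something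
    bounded.  The limit is fixed by [P], so [lambda] is a stationary
    distribution of the walk ([lambda_stationary]).

    [lambda] vanishes off the kernel [K].  The walk never leaves the ideal [K],
    so by stationarity no mass can enter it either: a state outside [K]
    that carries mass is sent outside [K] by every generator, and its images
    carry mass again.  Such a state would therefore stay outside [K] under
    left multiplication by all of [S], in particular by an element of [K],
    which is absurd ([lambda_off_ideal]). *)

Set Implicit Arguments.
Unset Strict Implicit.
Unset Printing Implicit Defensive.

(** * Kronecker powers *)

Lemma castmxM (R : pzSemiRingType) (m m' : nat) (e : m = m') (A B : 'M[R]_m) :
  castmx (e, e) (A *m B) = castmx (e, e) A *m castmx (e, e) B.
Proof. by case: m' / e; rewrite !castmx_id. Qed.

Lemma kron_powM (R : realType) (n l : nat) (A B : 'M[R]_n) :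
  kron_pow (A *m B) l = kron_pow A l *m kron_pow B l.
Proof.
elim: l => [|l IHl] /=; first by rewrite mulmx1.
by rewrite IHl tprodE castmxM.
Qed.

(** * The mean ergodic theorem for matrices with bounded orbits *)

(** Write [E = 1 - P].  If [u = b *m E] is fixed by [P] then
    [b *m P ^+ m = b - u *+ m], which is bounded in [m] only for [u = 0].  So
    the kernel and the image of [E] meet trivially, and by rank-nullity they
    span the whole space. *)
Lemma fixed_kernel_decomposition (R : realType) (N : nat) (P : 'M[R]_N)
    (bounded_orbits : forall b : 'rV[R]_N, exists B : R,
      forall m, `|b *m P ^+ m| <= B) (v : 'rV[R]_N) :
  exists a b : 'rV[R]_N, a *m P = a /\ v = a + (b - b *m P).
Proof.
set E := 1%:M - P.
have EM p (x : 'M[R]_(p, N)) : x *m E = x - x *m P.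
  by rewrite mulmxBr mulmx1.
have cap0 : (kermx E :&: E)%MS = 0.
  apply/eqP/rowV0P => u; rewrite sub_capmx => /andP[/sub_kermxP uE].
  move=> /submxP[b ub].
  have uP : u *m P = u by apply/esym/eqP; rewrite -subr_eq0 -EM uE.
  have bP1 : b *m P = b - u by rewrite ub EM opprB addrC subrK.
  have bP m : b *m P ^+ m = b - u *+ m.
    elim: m => [|m IHm]; first by rewrite expr0 mulmx1 subr0.
    rewrite exprSr [_ * P]/(_ *m P) mulmxA IHm mulmxBl -scaler_nat.
    rewrite -scalemxAl uP.
    by rewrite scaler_nat bP1 mulrS opprD addrA.
  have [B bB] := bounded_orbits b.
  apply/eqP; rewrite -normr_eq0 eq_le normr_ge0 andbT leNgt; apply/negP => u0.
  have B0 : 0 <= B + `|b|.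
    by rewrite addr_ge0// (le_trans _ (bB 0%N)).
  (* [`|u|] times this integer exceeds [B + `|b|], which [bP] forbids. *)
  have := archi_boundP (divr_ge0 B0 (ltW u0)).
  set m := Num.bound _; rewrite ltr_pdivrMr// ltNge => /negP; apply.
  rewrite mulr_natl -normrMn -[u *+ m](subKr b) -bP.
  by rewrite (le_trans (ler_normB _ _))// addrC lerD.
have /sub_addsmxP[[x b] /= vE] : (v <= kermx E + E)%MS.
  apply: submx_full; rewrite /row_full (mxrank_disjoint_sum cap0) mxrank_ker.
  by rewrite subnK// rank_leq_row.
exists (x *m kermx E), b; split; last by rewrite -EM.
by apply/esym/eqP; rewrite -subr_eq0 -EM -mulmxA mulmx_ker mulmx0.
Qed.

(** The exponent [m.-1] makes the averaged sequence start at [v] itself, since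
    the Cesaro mean is taken over [1 <= m]. *)
Theorem mean_ergodic (R : realType) (N : nat) (P : 'M[R]_N)
    (bounded_orbits : forall b : 'rV[R]_N, exists B : R,
      forall m, `|b *m P ^+ m| <= B) (v : 'rV[R]_N) :
  exists a : 'rV[R]_N, a *m P = a /\
    cesaro_mean (fun m => v *m P ^+ m.-1) @ \oo --> a.
Proof.
have [a [b [aP ->]]] := fixed_kernel_decomposition bounded_orbits v.
exists a; split=> //.
have [B bB] := bounded_orbits b.
have aPm m : a *m P ^+ m = a.
  elim: m => [|m IHm]; first by rewrite expr0 mulmx1.
  by rewrite exprSr [_ * P]/(_ *m P) mulmxA IHm.
have mean M : \sum_(1 <= m < M.+1) (a + (b - b *m P)) *m P ^+ m.-1
    = a *+ M + (b - b *m P ^+ M).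
  elim: M => [|M IHM].
    by rewrite big_geq// mulr0n expr0 mulmx1 subrr addr0.
  rewrite big_nat_recr//= IHM mulmxDl aPm mulmxBl -mulmxA.
  rewrite -[P *m _]/(P * _) -exprS mulrSr addrACA; congr (_ + _).
  by rewrite addrA subrK.
apply/cvgrPdist_le => e e0; near=> M.
have M0 : 0 < M%:R :> R by rewrite ltr0n; near: M; exact: nbhs_infty_gt.
rewrite /cesaro_mean mean scalerDr -[a *+ M]scaler_nat scalerA mulVf ?gt_eqF//.
rewrite scale1r opprD addNKr normrN normrZ gtr0_norm ?invr_gt0//.
rewrite ler_pdivrMl// (le_trans (ler_normB _ _))//.
rewrite (le_trans (lerD (lexx _) (bB M)))// -ler_pdivrMr//.
near: M; exact: nbhs_infty_ger.
Unshelve. all: by end_near. Qed.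

(** * The semigroup and its kernel *)

Definition fun_mx (R : realType) (n : nat) (f : {ffun 'I_n -> 'I_n}) :
  'M[R]_n := \matrix_(i, j) (f i == j)%:R.

Lemma fun_mxM (R : realType) (n : nat) (f g : {ffun 'I_n -> 'I_n}) :
  fun_mx R f *m fun_mx R g = fun_mx R [ffun i => g (f i)].
Proof.
apply/matrixP => i k; rewrite !mxE (bigD1 (f i))//= !mxE eqxx mul1r ffunE.
by rewrite big1 ?addr0// => j ji; rewrite mxE eq_sym (negPf ji) mul0r.
Qed.

Lemma binary_stochastic_fun_mx (R : realType) (n : nat) (C : 'M[R]_n) :
  binary_stochastic C -> exists f, fun_mx R f = C.
Proof.
move=> [C01 Crow].
have [f fP] := fin_all_exists Crow.
exists [ffun i => f i]; apply/matrixP => i j; rewrite mxE ffunE.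
have [Cfi uniq_fi] := fP i; case: eqP => [<- //|fij].
by have [//|Cij] := C01 i j; case: fij; apply: uniq_fi.
Qed.

Lemma mulmx_closed_semigroup (R : realType) (n d : nat)
    (C : 'I_d -> 'M[R]_n) : mulmx_closed (semigroup_gen C).
Proof.
move=> x y Sx Sy T CT; have [closedT _] := CT.
exact: (closedT x y (Sx T CT) (Sy T CT)).
Qed.

Lemma generator_semigroup (R : realType) (n d : nat) (C : 'I_d -> 'M[R]_n)
    (i : 'I_d) : semigroup_gen C (C i).
Proof. by apply: sub_gen_smallest; exists i. Qed.

Lemma finite_semigroup (R : realType) (n d : nat) (C : 'I_d -> 'M[R]_n) :
  (forall i, binary_stochastic (C i)) -> finite_set (semigroup_gen C).
Proof.
move=> C_bin.
apply: (@sub_finite_set _ _ (range (@fun_mx R n))); last first.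
  by apply: finite_image; exact: finite_finset.
apply: smallest_sub => [_ _ [f _ <-] [g _ <-]|_ [i _ <-]].
  by rewrite fun_mxM; exists [ffun i => g (f i)].
by have [f <-] := binary_stochastic_fun_mx (C_bin i); exists f.
Qed.

(** [semigroup_kernel S] is a choice among the minimal ideals of [S], so it
    is an ideal once a minimal one exists: an ideal of smallest cardinality. *)
Lemma semigroup_kernel_ideal (R : realType) (n : nat) (S : set 'M[R]_n) :
  finite_set S -> S !=set0 -> mulmx_closed S ->
  two_sided_ideal S (semigroup_kernel S).
Proof.
move=> finS S0 closedS.
suff /(xgetPex set0)[] : exists K, minimal_ideal S K by [].
pose has_ideal k := `[< exists2 I, two_sided_ideal S I &
                          #|` fset_set I| = k >].
have ex_k : exists k, has_ideal k.
  exists #|` fset_set S|; apply/asboolP; exists S => //.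
  by split=> // s x Ss Sx; split; exact: closedS.
have := ex_minnP ex_k; case=> k /asboolP[K idK <-] kmin.
exists K; split=> // I idI IK.
have [[_ KS _] [_ IS _]] := (idK, idI).
have finK := sub_finite_set KS finS; have finI := sub_finite_set IS finS.
have cardKI : (#|` fset_set K| <= #|` fset_set I|)%N.
  by apply: kmin; apply/asboolP; exists I.
have subIK : (fset_set I `<=` fset_set K)%fset by rewrite -fset_set_sub.
have /eqP eqIK : fset_set I == fset_set K by rewrite eqEfcard subIK.
by rewrite -[LHS](fset_setK finI) eqIK fset_setK.
Qed.

(** * Convolution powers as a random walk *)

Lemma big_uniq_eq (R : pzRingType) (V : lmodType R) (T : eqType) (s : seq T)
    (x : T) (F : T -> V) :
  uniq s -> x \in s -> \sum_(y <- s) (x == y)%:R *: F y = F x.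
Proof.
move=> us xs; rewrite (bigD1_seq x)//= eqxx scale1r big1_seq ?addr0//.
by move=> y /andP[yx _]; rewrite eq_sym (negPf yx) scale0r.
Qed.

(** Integrating [F] against a convolution amounts to integrating the function
    [F (x *m y)] against the product measure.  Letting [F] take values in a
    module covers point masses ([F] an indicator) and the expansion of
    [A_tensor] ([F = kron_pow _ l]) at once. *)
Lemma convolution_sum (R : realType) (n : nat) (V : lmodType R)
    (s : seq 'M[R]_n) (f g : 'M[R]_n -> R) (F : 'M[R]_n -> V) :
  uniq s -> mulmx_closed [set` s] ->
  \sum_(u <- s) convolution [set` s] f g u *: F u =
  \sum_(x <- s) f x *: \sum_(y <- s) g y *: F (x *m y).
Proof.
move=> us closeds.
have convE u : convolution [set` s] f g u =
    \sum_(x <- s) \sum_(y <- s) (x *m y == u)%:R * (f x * g y).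
  set t := [seq (x, y) | x <- s, y <- s].
  have -> : convolution [set` s] f g u =
      \sum_(p <- [seq p <- t | p.1 *m p.2 == u]) f p.1 * g p.2.
    rewrite fsbig_seq; last first.
      by rewrite filter_uniq// allpairs_uniq// => -[? ?] [? ?] _ _ [-> ->].
    apply: eq_fsbigl; apply/seteqP; split=> -[x y] /=.
      move=> [xs ys <-]; rewrite mem_filter eqxx /=.
      by apply/allpairsP; exists (x, y).
    rewrite mem_filter /= => /andP[/eqP xyu /allpairsP[[x' y'] /=]].
    by move=> [xs ys [ex ey]]; split; rewrite ?ex ?ey// -ex -ey.
  rewrite big_filter /t big_mkcond big_allpairs/=.
  apply: eq_bigr => x _; apply: eq_bigr => y _ /=.
  by case: eqP; rewrite ?mul1r ?mul0r.
under eq_bigr do rewrite convE scaler_suml.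
rewrite exchange_big; apply: eq_big_seq => x xs /=.
under eq_bigr do rewrite scaler_suml.
rewrite exchange_big scaler_sumr; apply: eq_big_seq => y ys /=.
rewrite scalerA -(big_uniq_eq F us (closeds _ _ xs ys)) scaler_sumr.
by apply: eq_bigr => u _; rewrite scalerA mulrC.
Qed.

Lemma mu1_sum (R : realType) (n d : nat) (V : lmodType R)
    (C : 'I_d -> 'M[R]_n) (s : seq 'M[R]_n) (F : 'M[R]_n -> V) :
  uniq s -> (forall i, C i \in s) ->
  \sum_(x <- s) mu1 C x *: F x = d%:R^-1 *: \sum_(i < d) F (C i).
Proof.
move=> us Cs.
have mu1E x : mu1 C x = d%:R^-1 * \sum_(i < d) (C i == x)%:R.
  rewrite /mu1 -sum1_card natr_sum big_mkcond/=; congr (_ * _).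
  by apply: eq_bigr => i _; rewrite inE; case: eqP.
under eq_bigr do rewrite mu1E -scalerA scaler_suml.
rewrite -scaler_sumr exchange_big; congr (_ *: _).
by apply: eq_bigr => i _; exact: big_uniq_eq.
Qed.

(** One step of the walk: the law at time [m + 2] is that of [C i *m y], with
    [i] uniform and [y] drawn from the law at time [m + 1]. *)
Lemma mu_step (R : realType) (n d : nat) (V : lmodType R)
    (C : 'I_d -> 'M[R]_n) (s : seq 'M[R]_n) (F : 'M[R]_n -> V) (m : nat) :
  uniq s -> semigroup_gen C = [set` s] ->
  \sum_(u <- s) mu C m.+2 u *: F u =
  \sum_(y <- s) mu C m.+1 y *: (d%:R^-1 *: \sum_(i < d) F (C i *m y)).
Proof.
move=> us Ss; have closeds : mulmx_closed [set` s].
  by rewrite -Ss; exact: mulmx_closed_semigroup.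
have Cs i : C i \in s.
  suff : [set` s] (C i) by [].
  by rewrite -Ss; exact: generator_semigroup.
rewrite [mu C m.+2]/(convolution _ _ (mu C m.+1)) Ss.
rewrite convolution_sum// mu1_sum//.
rewrite exchange_big scaler_sumr; apply: eq_bigr => y _ /=.
by rewrite -scaler_sumr !scalerA mulrC.
Qed.

Lemma mu_ge0 (R : realType) (n d : nat) (C : 'I_d -> 'M[R]_n) (m : nat) w :
  0 <= mu C m w.
Proof.
have mu1_ge0 x : 0 <= mu1 C x by rewrite mulr_ge0.
rewrite /mu; elim: m.-1 w => [|k IHk] w //=.
by apply: fsumr_ge0 => p _; rewrite mulr_ge0.
Qed.

(** * The random walk on the semigroup and its limit law *)

(** Right multiplication by a row-stochastic matrix does not increase the
    l1-norm of row vectors, and the l1-norm dominates the sup norm. *)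
Lemma stochastic_bounded_orbits (R : realType) (N : nat) (P : 'M[R]_N) :
  (forall j k, 0 <= P j k) -> (forall j, \sum_k P j k = 1) ->
  forall b : 'rV[R]_N, exists B : R, forall m, `|b *m P ^+ m| <= B.
Proof.
move=> P_ge0 P_row b; exists (\sum_j `|b 0 j|) => m.
apply: (@le_trans _ _ (\sum_j `|(b *m P ^+ m) 0 j|)).
  rewrite [leLHS]mx_normrE; apply/bigmax_leP; split=> [|[i j] _ /=].
    by apply: sumr_ge0.
  by rewrite ord1 (bigD1 j)//= lerDl; apply: sumr_ge0.
elim: m => [|m IHm]; first by rewrite expr0 mulmx1.
apply: le_trans IHm; rewrite exprSr [_ * P]/(_ *m P) mulmxA.
set c := b *m _.
apply: (@le_trans _ _ (\sum_k \sum_j `|c 0 j| * P j k)).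
  apply: ler_sum => k _; rewrite mxE (le_trans (ler_norm_sum _ _ _))//.
  by apply: ler_sum => j _; rewrite normrM (ger0_norm (P_ge0 _ _)).
rewrite exchange_big; apply: ler_sum => j _.
by rewrite -mulr_sumr P_row mulr1.
Qed.

(** The transition matrix of the walk [y |-> C i *m y], [i] uniform; the states
    are the positions in a list [s] of the elements of the semigroup. *)
Definition left_mul_mx (R : realType) (n d : nat) (C : 'I_d -> 'M[R]_n)
    (s : seq 'M[R]_n) : 'M[R]_(size s) :=
  \matrix_(j, k) (d%:R^-1 * \sum_(i < d) (s`_k == C i *m s`_j)%:R).

Lemma left_mul_mx_sum (R : realType) (n d : nat) (C : 'I_d -> 'M[R]_n)
    (s : seq 'M[R]_n) (j : 'I_(size s)) (F : 'M[R]_n -> R) :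
  uniq s -> (forall i, C i *m s`_j \in s) ->
  \sum_(k < size s) left_mul_mx C s j k * F s`_k =
  d%:R^-1 * \sum_(i < d) F (C i *m s`_j).
Proof.
move=> us Cs.
under eq_bigr do rewrite mxE -mulrA mulr_suml.
rewrite -mulr_sumr exchange_big; congr (_ * _); apply: eq_bigr => i _ /=.
under eq_bigr do rewrite eq_sym.
rewrite -(@big_uniq_eq R R^o _ s _ F us (Cs i)).
by rewrite (big_nth 0) big_mkord.
Qed.

(** Both parts come from the same row vector: the limit [a] given by the mean
    ergodic theorem has [lambda C] as its entries, and [a *m P = a]. *)
Lemma lambda_stationary (R : realType) (n d : nat)
    (C : 'I_d -> 'M[R]_n) (s : seq 'M[R]_n) :
  (0 < d)%N -> uniq s -> semigroup_gen C = [set` s] ->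
  (forall w, w \in s ->
     cesaro_mean (fun m => mu C m w : R^o) @ \oo --> lambda C w) /\
  (forall F : 'M[R]_n -> R, \sum_(u <- s) lambda C u * F u =
     \sum_(y <- s) lambda C y * (d%:R^-1 * \sum_(i < d) F (C i *m y))).
Proof.
move=> d0 us Ss.
have Cs i y : y \in s -> C i *m y \in s.
  move=> ys; suff : [set` s] (C i *m y) by [].
  rewrite -Ss; apply: mulmx_closed_semigroup; last by rewrite Ss.
  exact: generator_semigroup.
have Csnth i (j : 'I_(size s)) : C i *m s`_j \in s by rewrite Cs ?mem_nth.
pose P := left_mul_mx C s.
pose v : 'rV[R]_(size s) := \row_k mu1 C s`_k.
have bounded : forall b : 'rV[R]_(size s), exists B : R,
    forall m, `|b *m P ^+ m| <= B.
  apply: stochastic_bounded_orbits => [j k|j].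
    by rewrite mxE mulr_ge0 ?invr_ge0// sumr_ge0.
  under eq_bigr do rewrite -[P _ _]mulr1.
  rewrite (@left_mul_mx_sum _ _ _ C s j (fun=> 1))//.
  by rewrite sumr_const card_ord mulVf// pnatr_eq0 -lt0n.
have mu_row m k : (v *m P ^+ m) 0 k = mu C m.+1 s`_k.
  elim: m k => [|m IHm] k; first by rewrite expr0 mulmx1 mxE.
  rewrite exprSr [_ * P]/(_ *m P) mulmxA mxE.
  have /= := @mu_step R n d R^o C s (fun u => (s`_k == u)%:R : R^o) m us Ss.
  under eq_bigr => u _ do rewrite [_ *: _]mulrC.
  rewrite [X in X = _](@big_uniq_eq R R^o) ?mem_nth// => ->.
  rewrite (big_nth 0) big_mkord; apply: eq_bigr => j _.
  by rewrite IHm mxE.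
have [a [aP cvga]] := mean_ergodic bounded v.
have mean_a (k : 'I_(size s)) :
    cesaro_mean (fun m => mu C m s`_k : R^o) @ \oo --> a 0 k.
  have := @cvg_comp _ _ _ _ (fun M : 'rV[R]_(size s) => M 0 k) _ _ _ cvga
    (@coord_continuous R _ _ 0 k a).
  apply: cvg_trans; apply: near_eq_cvg; near=> M; rewrite /= /cesaro_mean.
  rewrite mxE summxE; congr (_ * _).
  by apply: eq_big_nat => m /andP[m0 _]; rewrite mu_row prednK.
have lambdaE (k : 'I_(size s)) : lambda C s`_k = a 0 k.
  by apply: cvg_lim; last exact: mean_a.
have cvg_lambda w : w \in s ->
    cesaro_mean (fun m => mu C m w : R^o) @ \oo --> lambda C w.
  rewrite -index_mem => ws; pose k := Ordinal ws.
  have -> : w = s`_k by rewrite nth_index// -index_mem.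
  by rewrite lambdaE; exact: mean_a.
split=> // F.
rewrite [LHS](big_nth 0) [RHS](big_nth 0) !big_mkord.
have aPE (k : 'I_(size s)) : lambda C s`_k = \sum_j a 0 j * P j k.
  by rewrite lambdaE -{1}aP mxE.
under eq_bigr => k _ do rewrite aPE mulr_suml.
rewrite exchange_big; apply: eq_bigr => j _ /=.
under eq_bigr do rewrite -mulrA.
by rewrite -mulr_sumr left_mul_mx_sum// lambdaE.
Unshelve. all: by end_near. Qed.

Lemma lambda_ge0 (R : realType) (n d : nat) (C : 'I_d -> 'M[R]_n)
    (w : 'M[R]_n) :
  cesaro_mean (fun m => mu C m w : R^o) @ \oo --> lambda C w ->
  0 <= lambda C w.
Proof.
move=> cvgw; rewrite /lambda; apply: limr_ge.
  by apply/cvg_ex; eexists; exact: cvgw.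
near=> M; rewrite /cesaro_mean mulr_ge0 ?invr_ge0// sumr_ge0// => m _.
exact: mu_ge0.
Unshelve. all: by end_near. Qed.

(** * The limit law is carried by the kernel *)

(** Stationarity applied to the indicator of [K] gives
    [\sum_(y <- s) lambda C y * gain y = 0], where [gain y] is the chance to
    be in [K] after one step from [y] minus that of being in [K] now.  It is
    nonnegative since [K] is an ideal, so each term vanishes.  Hence the set
    [bad] of states outside [K] that carry mass is stable under left
    multiplication by the generators, then by the whole semigroup, although
    left multiplication by an element of [K] leads into [K]. *)
Lemma lambda_off_ideal (R : realType) (n d : nat) (C : 'I_d -> 'M[R]_n)
    (s : seq 'M[R]_n) (K : set 'M[R]_n) :
  (0 < d)%N -> uniq s -> semigroup_gen C = [set` s] ->
  two_sided_ideal (semigroup_gen C) K ->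
  forall w, semigroup_gen C w -> ~ K w -> lambda C w = 0.
Proof.
move=> d0 us Ss [K0 KS Kideal] w0 Sw0 Kw0; apply/eqP/negPn/negP => lw0.
have [cvg_lambda stat] := lambda_stationary d0 us Ss.
have SP x : semigroup_gen C x <-> x \in s by rewrite Ss.
have SC i : semigroup_gen C (C i) by exact: generator_semigroup.
have l_ge0 x : x \in s -> 0 <= lambda C x.
  by move=> xs; apply: lambda_ge0; exact: cvg_lambda.
have dV0 : 0 < d%:R^-1 :> R by rewrite invr_gt0 ltr0n.
pose inK x : R := (`[< K x >])%:R.
pose gain y : R := d%:R^-1 * (\sum_(i < d) inK (C i *m y)) - inK y.
have gain_ge0 y : y \in s -> 0 <= gain y.
  move=> /SP Sy; rewrite subr_ge0 /inK; case: asboolP => Ky; last first.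
    by rewrite mulr_ge0 ?invr_ge0// sumr_ge0.
  under eq_bigr => i _.
    have -> : `[< K (C i *m y) >].
      by apply/asboolP; exact: (Kideal _ _ (SC i) Ky).1.
    over.
  by rewrite sumr_const card_ord mulVf// pnatr_eq0 -lt0n.
have gain0 : forall y, y \in s -> lambda C y * gain y = 0.
  have : \sum_(y <- s) lambda C y * gain y = 0.
    under eq_bigr do rewrite mulrBr.
    by rewrite sumrB -stat subrr.
  rewrite big_seq => /eqP; rewrite psumr_eq0 => [|y ys]; last first.
    by rewrite mulr_ge0 ?l_ge0 ?gain_ge0.
  by move=> /allP all0 y ys; have := all0 _ ys; rewrite ys => /eqP.
pose bad := [set y | [/\ y \in s, lambda C y != 0 & ~ K y]].
have badC i y : bad y -> bad (C i *m y).
  move=> [ys ly Ky].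
  have Cys : C i *m y \in s.
    by apply/SP; apply: mulmx_closed_semigroup; [exact: SC|exact/SP].
  split=> //.
    (* Balance at [C i *m y]: it receives at least the mass [lambda C y / d]. *)
    have := stat (fun u => (C i *m y == u)%:R).
    under eq_bigr do rewrite mulrC.
    rewrite [X in X = _](@big_uniq_eq R R^o)// => ->.
    rewrite gt_eqF// (bigD1_seq y)//=.
    apply: ltr_pwDl; last first.
      rewrite big_seq_cond sumr_ge0// => x /andP[xs _].
      by rewrite !mulr_ge0 ?l_ge0 ?(ltW dV0)// sumr_ge0.
    apply: mulr_gt0; first by rewrite lt_def ly l_ge0.
    apply: mulr_gt0 => //.
    by rewrite (bigD1 i)//= eqxx ltr_pwDl// sumr_ge0.
  move=> KCy; move/eqP: (gain0 _ ys); rewrite mulf_eq0 (negPf ly) /= gt_eqF//.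
  rewrite /gain /inK; case: (asboolP (K y)) => // _; rewrite subr0 mulr_gt0//.
  rewrite (bigD1 i)//= ltr_pwDl ?sumr_ge0//.
  by case: asboolP => // /(_ KCy).
have badS : semigroup_gen C `<=` [set w | forall y, bad y -> bad (w *m y)].
  apply: smallest_sub => [x y bx bz z /bz /bx|_ [i _ <-] y]; last exact: badC.
  by rewrite mulmxA.
have [k Kk] := K0.
have [|_ _] := badS _ (KS _ Kk) w0; first by split=> //; exact/SP.
by apply; exact: (Kideal _ _ Sw0 Kk).2.
Qed.

(** * Convergence of the Cesaro means of the tensor powers *)

Unset Implicit Arguments.
Set Strict Implicit.
Set Printing Implicit Defensive.

Theorem proposition4p4 (R : realType) (n d : nat) (D : 'M[nat]_n)
    (A : 'M[R]_n) (C : 'I_d -> 'M[R]_n) (l : nat)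
    (d_gt0 : (0 < d)%N)
    (D_reg : out_regular d D)
    (A_def : A = d%:R^-1 *: map_mx (fun k : nat => k%:R) D)
    (A_irr : irreducible_mx A)
    (A_aper : aperiodic_mx A)
    (C_bin : forall i : 'I_d, binary_stochastic (C i))
    (A_dec : A = d%:R^-1 *: \sum_(i < d) C i)
    (l_gt0 : (0 < l)%N) :
  cesaro_mean (fun m : nat => A_tensor C l ^+ m) @ \oo --> Omega_tensor C l.
Proof.
have finS := finite_semigroup C_bin.
have S0 : semigroup_gen C !=set0.
  by exists (C (Ordinal d_gt0)); exact: generator_semigroup.
have [s' Ss'] := (finite_seqP _).1 finS.
pose s := undup s'.
have us : uniq s := undup_uniq s'.
have Ss : semigroup_gen C = [set` s].
  by rewrite Ss'; apply/seteqP; split=> x /=; rewrite mem_undup.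
have idK := semigroup_kernel_ideal finS S0 (@mulmx_closed_semigroup _ _ _ C).
have [cvg_lambda _] := lambda_stationary d_gt0 us Ss.
have -> : Omega_tensor C l = \sum_(w <- s) lambda C w *: kron_pow w l.
  have [_ KS _] := idK.
  apply: fsbig_fwiden => //; first by rewrite -Ss.
  move=> w [ws Kw] /=.
  by rewrite (lambda_off_ideal d_gt0 us Ss idK) ?scale0r// Ss.
have Cs i : C i \in s.
  by suff : [set` s] (C i) by []; rewrite -Ss; exact: generator_semigroup.
have powE m : A_tensor C l ^+ m.+1 = \sum_(w <- s) mu C m.+1 w *: kron_pow w l.
  elim: m => [|m IHm].
    by rewrite expr1 [mu C 1]/(mu1 C) mu1_sum// scaler_sumr.
  rewrite (mu_step (fun w => kron_pow w l))// exprS IHm [LHS]mulmx_sumr.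
  apply: eq_bigr => w _; rewrite -scalemxAr; congr (_ *: _).
  rewrite mulmx_suml scaler_sumr; apply: eq_bigr => i _.
  by rewrite -scalemxAl kron_powM.
have meanE M : cesaro_mean (fun m => A_tensor C l ^+ m) M =
    \sum_(w <- s) cesaro_mean (fun m => mu C m w : R^o) M *: kron_pow w l.
  rewrite /cesaro_mean.
  transitivity (M%:R^-1 *:
      \sum_(w <- s) \sum_(1 <= m < M.+1) mu C m w *: kron_pow w l).
    rewrite exchange_big; congr (_ *: _).
    by apply: eq_big_nat => -[//|m] _; exact: powE.
  by rewrite scaler_sumr; apply: eq_bigr => w _; rewrite -scaler_suml scalerA.
rewrite (_ : cesaro_mean _ = fun M => \sum_(w <- s)
    cesaro_mean (fun m => mu C m w : R^o) M *: kron_pow w l); last exact/funext.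
rewrite big_seq; under eq_fun do rewrite big_seq.
apply: cvg_big => [|w ws]; first exact: add_continuous.
by apply: cvgZr_tmp; exact: cvg_lambda.
Qed.
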